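(* Define $a_k=k(k-1)$ for $k\ge 2$ and $a_1=-1$. For every integer $n\ge1$, the polynomial $A_{n,2}(x)$ is given by $$A_{n,2}(x)=\frac{1}{i\,n!}\sum_{k=1}^{n}\frac{x^k}{a_k}\left[(x+i)^{n-k+1}-(x-i)^{n-k+1}\right],$$ and this can be written as $$A_{n,2}(x)=\frac{1}{n!}\sum_{k=1}^{n}\frac{(n-k+1)!}{a_k}\,x^k B_{n-k+1,2}(x).$$
   Context: Let $f_0(x)=\ln(1+x^2)$ and $f_n(x)=\int_0^x f_{n-1}(t)\,dt$ for $n\ge1$ ($x$ real). For each $n\ge 0$, $A_{n,2},B_{n,2},C_{n,2}$ denote the (uniquely determined) polynomials with $$f_n(x)=A_{n,2}(x)+B_{n,2}(x)\arctan x+C_{n,2}(x)\ln(1+x^2).$$ Here $i=\sqrt{-1}$. *)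

(* Defs.v *)
From HB Require Import structures.
From mathcomp Require Import all_boot all_order all_algebra.
From mathcomp Require Import complex.
From mathcomp Require Import boolp classical_sets reals topology normedtype.
From mathcomp Require Import exp trigo measure lebesgue_measure.
From mathcomp Require Import lebesgue_integral.

Set Implicit Arguments.
Unset Strict Implicit.
Unset Printing Implicit Defensive.

Import Order.TTheory GRing.Theory Num.Theory.
Import numFieldNormedType.Exports.

Local Open Scope classical_set_scope.
Local Open Scope ring_scope.

(* Oriented integral: the Lebesgue integral over `[a, b] is 0 when b < a. *)
Definition oint (R : realType) (g : R -> R) (a b : R) : R :=
  if a <= b then \int[@lebesgue_measure R]_(t in `[a, b]) g t
  else - \int[@lebesgue_measure R]_(t in `[b, a]) g t.

Fixpoint iterln (R : realType) (n : nat) : R -> R :=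
  if n is m.+1 then fun x => oint (iterln m) 0 x
  else fun x => ln (1 + x ^+ 2).

Definition decomposes (R : realType) (f : R -> R) (A B C : {poly R}) : Prop :=
  forall x : R, f x = A.[x] + B.[x] * atan x + C.[x] * ln (1 + x ^+ 2).

(* The triple is unique, so the choice made by [xget] is immaterial; the
   default (0, 0, 0) does not decompose any of the functions [iterln n]. *)
Definition iterln_coefs (R : realType) (n : nat) :
    {poly R} * {poly R} * {poly R} :=
  xget (0, 0, 0) [set p | decomposes (@iterln R n) p.1.1 p.1.2 p.2].

Definition A2 (R : realType) (n : nat) : {poly R} := (iterln_coefs R n).1.1.
Definition B2 (R : realType) (n : nat) : {poly R} := (iterln_coefs R n).1.2.
Definition C2 (R : realType) (n : nat) : {poly R} := (iterln_coefs R n).2.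

(* Only used for k >= 1. *)
Definition acoef (k : nat) : int :=
  if k == 1%N then -1 else k%:Z * (k%:Z - 1).

(* Main.v *)
Require Import Defs.
From mathcomp Require Import all_boot all_order all_algebra.
From mathcomp Require Import complex reals.
From mathcomp Require Import boolp classical_sets functions topology normedtype.
From mathcomp Require Import derive realfun exp trigo measure lebesgue_measure.
From mathcomp Require Import lebesgue_integral ftc.
From mathcomp Require Import polyorder.
From mathcomp Require Import ring lra zify.

(** Write (x + i)^n = U_n + i V_n with U_n, V_n real polynomials.  Then
    f_n = A_n + B_n arctan + C_n ln (1 + x^2) with B_n = 2 V_n / n!,
    C_n = U_n / n! and A_n = (2 / n!) \sum_k x^k V_(n-k+1) / a_k: the logarithmic
    and arctangent parts are obvious, and A_(n+1)' = A_n - 2 U_n / (n+1)! holds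
    because the sum telescopes.  Uniqueness of the triple is proved by
    differentiating a relation A + E^m (B arctan + C ln E) = 0, E = 1 + x^2,
    which lowers the degrees of B and C, until they are constants b and c; then
    (b + 2 c x) / E would be the derivative of a rational function with
    denominator a power of E, which is only possible for b = c = 0. *)

Set Implicit Arguments.
Unset Strict Implicit.

Import Order.TTheory GRing.Theory Num.Theory numFieldNormedType.Exports.
Local Open Scope ring_scope.

Section ReIm.
Variable K : comNzRingType.

Fixpoint reim_pow (n : nat) : {poly K} * {poly K} :=
  if n is m.+1 then
    ('X * (reim_pow m).1 - (reim_pow m).2, 'X * (reim_pow m).2 + (reim_pow m).1)
  else (1, 0).

Definition re_pow n := (reim_pow n).1.
Definition im_pow n := (reim_pow n).2.

Lemma re_powS n : re_pow n.+1 = 'X * re_pow n - im_pow n.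
Proof. by []. Qed.

Lemma im_powS n : im_pow n.+1 = 'X * im_pow n + re_pow n.
Proof. by []. Qed.

Lemma deriv_reim_pow n :
  (re_pow n.+1)^`() = n.+1%:R * re_pow n /\
  (im_pow n.+1)^`() = n.+1%:R * im_pow n.
Proof.
elim: n => [|n [IHre IHim]].
  by rewrite re_powS im_powS /re_pow /im_pow /= !poly.derivE; split; ring.
rewrite (re_powS n.+1) (im_powS n.+1).
rewrite (derivB ('X * re_pow n.+1)) (derivD ('X * im_pow n.+1)).
rewrite (derivM 'X (re_pow n.+1)) (derivM 'X (im_pow n.+1)) derivX IHre IHim.
by rewrite re_powS im_powS -[n.+2%:R]natr1; split; ring.
Qed.

Lemma deriv_re_pow n : (re_pow n)^`() = n%:R * re_pow n.-1.
Proof.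
case: n => [|n]; last by case: (deriv_reim_pow n).
by rewrite /re_pow /= !poly.derivE mul0r.
Qed.

Lemma deriv_im_pow n : (im_pow n)^`() = n%:R * im_pow n.-1.
Proof.
case: n => [|n]; last by case: (deriv_reim_pow n).
by rewrite /im_pow /= !poly.derivE mul0r.
Qed.

(* The real part of (x - i) (x + i)^(n+1) = (1 + x^2) (x + i)^n. *)
Lemma im_powDre_pow n :
  im_pow n.+1 + 'X * re_pow n.+1 = (1 + 'X^2) * re_pow n.
Proof. by rewrite re_powS im_powS; ring. Qed.

End ReIm.

Lemma reim_powE (R : rcfType) n :
  let re := map_poly (real_complex R) (re_pow R n) in
  let im := map_poly (real_complex R) (im_pow R n) in
  ('X + ('i%C)%:P) ^+ n = re + ('i%C)%:P * im /\
  ('X - ('i%C)%:P) ^+ n = re - ('i%C)%:P * im.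
Proof.
elim: n => [|n [IHp IHm]] /=.
  by rewrite /re_pow /im_pow /= !rmorph1 !rmorph0 mulr0 addr0 subr0.
have iE : ('i%C)%:P * ('i%C)%:P = -1 :> {poly R[i]}.
  by rewrite -polyCM -expr2 sqr_i polyCN.
rewrite !exprS IHp IHm re_powS im_powS.
rewrite [map_poly _ ('X * _ - _)]rmorphB [map_poly _ ('X * _ + _)]rmorphD.
rewrite !rmorphM /= !map_polyX.
by split; ring: iE.
Qed.

Section Apart.
Variable K : numFieldType.

Definition apart n : {poly K} :=
  \sum_(1 <= k < n.+1) ((acoef k)%:~R^-1 : K) *: ('X^k * im_pow K (n - k + 1)).

Lemma acoef1 : (acoef 1)%:~R = -1 :> K. Proof. by []. Qed.

Lemma acoefSS k : (acoef k.+2)%:~R = k.+2%:R * k.+1%:R :> K.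
Proof.
have -> : acoef k.+2 = (k.+2 * k.+1)%:Z by rewrite /acoef /=; lia.
by rewrite -pmulrn natrM.
Qed.

Lemma deriv_apart n :
  (apart n.+1)^`() = n.+1%:R *: apart n - re_pow K n.
Proof.
have nz m : m.+1%:R != 0 :> K by rewrite pnatr_eq0.
pose h j : {poly K} :=
  if j is 0 then - re_pow K n else j%:R^-1 *: ('X^j * im_pow K (n.+1 - j)).
pose b j : K := (acoef j.+1)%:~R^-1.
have apartE m : apart m = \sum_(j < m) b j *: ('X^(j.+1) * im_pow K (m - j)).
  rewrite /apart big_add1 /= big_mkord; apply: eq_bigr => j _.
  by congr (_ *: (_ * im_pow K _)); have := ltn_ord j; lia.
have -> : apart n = \sum_(j < n.+1) b j *: ('X^(j.+1) * im_pow K (n - j)).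
  by rewrite big_ord_recr /= subnn mulr0 scaler0 addr0.
rewrite apartE raddf_sum; apply/eqP; rewrite addrC -subr_eq; apply/eqP.
rewrite scaler_sumr -sumrB.
transitivity (\sum_(j < n.+1) (h j - h j.+1)).
  apply: eq_bigr => -[j /= lt_j _].
  rewrite linearZ /= derivM derivXn deriv_im_pow /= subSn // /h /b.
  case: j lt_j => [|j] lt_j.
    rewrite acoef1 subn0 subSS subn0 invr1 invrN invr1 im_powS -natr1.
    by rewrite -!mul_polyC; ring.
  rewrite acoefSS (subSS j.+1 n); set p := (n - j.+1)%N.
  have -> : (n.+1 - j.+1 = p.+1)%N by rewrite subSn.
  have -> : (n = p + j.+1)%N by rewrite subnK.
  have uE : j.+1%:R * (j.+1%:R^-1)%:P = 1 :> {poly K}.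
    by rewrite -polyC_natr -polyCM mulfV.
  have vE : j.+2%:R * (j.+2%:R^-1)%:P = 1 :> {poly K}.
    by rewrite -polyC_natr -polyCM mulfV.
  rewrite invfM -!mul_polyC polyCM polyC_natr !exprS /=.
  move: uE vE; set u := polyC _; set v := polyC _ => uE vE.
  rewrite -mulr_natr -[(p + _).+1%:R]natr1 natrD -[p.+1%:R]natr1.
  move: (im_pow K p) (im_pow K p.+1) => V W.
  transitivity ((j.+2%:R * v) * u * ('X * 'X^j * W)
                - (j.+1%:R * u) * v * ('X * ('X * 'X^j) * V)); first by ring.
  by rewrite uE vE; ring.
rewrite -(big_mkord xpredT (fun j => h j - h j.+1)).
rewrite -[LHS]opprK -sumrN.
under eq_bigr do rewrite opprB.
by rewrite telescope_sumr // /h subnn mulr0 scaler0 sub0r opprK.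
Qed.
End Apart.

Section Poly.
Variable K : realFieldType.

Lemma deriv_eq0_const (p : {poly K}) : p^`() = 0 -> p = (p`_0)%:P.
Proof.
move=> p'0; apply: size1_polyC.
by have := size_deriv p; rewrite p'0 size_poly0; case: size => [|[]].
Qed.

Lemma horner_eq0 (p : {poly K}) : (forall x, p.[x] = 0) -> p = 0.
Proof.
move=> p0; apply: (@roots_geq_poly_eq0 _ p [seq i%:R | i <- iota 0 (size p)]).
- by apply/allP => x _; rewrite /root p0.
- rewrite map_inj_uniq ?iota_uniq // => i j /eqP; rewrite eqr_nat; exact/eqP.
- by rewrite size_map size_iota.
Qed.

(* The hypothesis says F / E = (Q / E^m)' for E = 1 + x^2. *)
Lemma proper_fraction_primitive m (F Q : {poly K}) : (size F <= 2)%N ->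
  F * (1 + 'X^2) ^+ m = Q^`() * (1 + 'X^2) - (m%:R * 2%:R) * 'X * Q -> F = 0.
Proof.
move=> szF; have szE : size (1 + 'X^2 : {poly K}) = 3.
  by rewrite addrC size_polyDl ?size_polyXn // size_poly1.
have E0 : 1 + 'X^2 != 0 :> {poly K} by rewrite -size_poly_eq0 szE.
elim: m Q => [|m IH] Q.
  rewrite expr0 mulr1 !mul0r subr0 => FE.
  have [Q'0|Q'0] := eqVneq Q^`() 0; first by rewrite FE Q'0 mul0r.
  move: szF; rewrite FE size_mul // szE addnC.
  by move: Q'0; rewrite -size_poly_gt0; case: size.
move=> FE; pose c : K := (m.+1%:R * 2)^-1.
have cE : (m.+1%:R * 2%:R) * c%:P = 1 :> {poly K}.
  rewrite -!polyC_natr -!polyCM mulfV //.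
  by rewrite mulf_neq0 // pnatr_eq0.
pose S := Q^`() - F * (1 + 'X^2) ^+ m.
have SE : (m.+1%:R * 2%:R) * ('X * Q) = (1 + 'X^2) * S.
  by rewrite /S mulrBr [_ * (F * _)]mulrCA -exprS FE; ring.
have [Q1 QE] : exists Q1, Q = (1 + 'X^2) * Q1.
  exists (Q - c%:P * 'X * S); rewrite mulrBr.
  have XQ : 'X * Q = c%:P * (1 + 'X^2) * S.
    by rewrite -mulrA -SE mulrA [c%:P * _]mulrC cE mul1r.
  transitivity ((1 + 'X^2) * Q - 'X * ('X * Q)); first by ring.
  by rewrite [in LHS]XQ; ring.
apply: (IH Q1); apply: (mulIf E0).
rewrite -[LHS]mulrA -exprSr FE QE derivM !poly.derivE -[m.+1%:R]natr1; ring.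
Qed.

End Poly.

Section FTC.
Variable R : realType.

Lemma FTC2_derive (f F : R -> R) (a b : R) : a <= b ->
  (forall x, is_derive x (1 : R) F (f x)) -> continuous f ->
  (\int[@lebesgue_measure R]_(t in `[a, b]%classic) f t)%R = F b - F a.
Proof.
move=> le_ab dF cf.
have cF : continuous F.
  by move=> x; apply/differentiable_continuous/derivable1_diffP.
move: le_ab; rewrite le_eqVlt => /predU1P[<-|lt_ab].
  by rewrite set_itv1 Rintegral_set1 subrr.
rewrite /Rintegral (@continuous_FTC2 _ f F) //.
- exact: continuous_subspaceT.
- split=> [x _||]; first by case: (dF x).
    exact/cvg_at_right_filter/cF.
  exact/cvg_at_left_filter/cF.
- by move=> x _; rewrite derive1E; exact: derive_val.
Qed.

Lemma oint_derive (f F : R -> R) (a b : R) :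
  (forall x, is_derive x (1 : R) F (f x)) -> continuous f ->
  oint f a b = F b - F a.
Proof.
move=> dF cf; rewrite /oint; case: (leP a b) => [le_ab|lt_ba].
  exact: FTC2_derive.
by rewrite (@FTC2_derive _ F) ?opprB // ltW.
Qed.
End FTC.

Section Comb.
Variable R : realType.
Implicit Types (A B C : {poly R}) (x : R).

Definition comb A B C x := A.[x] + B.[x] * atan x + C.[x] * ln (1 + x ^+ 2).

Lemma sqrD1_gt0 x : 0 < 1 + x ^+ 2.
Proof. by rewrite ltr_pwDl // sqr_ge0. Qed.

Lemma is_derive_comb A B C x :
  is_derive x (1 : R) (comb A B C)
    (comb A^`() B^`() C^`() x + (B.[x] + 2%:R * x * C.[x]) / (1 + x ^+ 2)).
Proof.
have dln : is_derive x (1 : R) (fun y => ln (1 + y ^+ 2))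
    ((1 + x ^+ 2)^-1 * (2%:R * x)).
  have -> : (fun y => ln (1 + y ^+ 2)) = @ln R \o horner (1 + 'X^2 : {poly R}).
    by apply/funext => y /=; rewrite !hornerE.
  have -> : 2%:R * x = (1 + 'X^2 : {poly R})^`().[x].
    by rewrite !poly.derivE !hornerE; ring.
  apply: is_derive1_comp; rewrite !hornerE; exact/is_derive1_ln/sqrD1_gt0.
have nz := lt0r_neq0 (sqrD1_gt0 x).
pose d := @is_deriveD _ _ _ _ _ _ _ _ _
  (@is_deriveD _ _ _ _ _ _ _ _ _ (is_derive_poly A x)
  (@is_deriveM _ _ _ _ _ _ _ _ (is_derive_poly B x) (is_derive1_atan x)))
  (@is_deriveM _ _ _ _ _ _ _ _ (is_derive_poly C x) dln).
apply: (is_derive_eq d); rewrite /comb /GRing.scale /=.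
by field.
Qed.

Lemma continuous_comb A B C : continuous (comb A B C).
Proof.
move=> x; apply/differentiable_continuous/derivable1_diffP.
by case: (is_derive_comb A B C x).
Qed.

Lemma deriv_comb0 A B C : (forall x, comb A B C x = 0) ->
  forall x, (1 + x ^+ 2) * comb A^`() B^`() C^`() x
            + (B.[x] + 2%:R * x * C.[x]) = 0.
Proof.
move=> ABC0 x; have dABC := is_derive_comb A B C x.
have E0 : comb A B C = cst 0 by apply/funext.
have := @derive_val _ _ _ _ _ _ _ dABC; rewrite E0 derive_cst => /esym h.
have nz := lt0r_neq0 (sqrD1_gt0 x).
apply: (mulIf (invr_neq0 nz)); rewrite mul0r -[RHS]h.
by field.
Qed.

Lemma comb_free A B C m :
  (forall x, comb A ((1 + 'X^2) ^+ m * B) ((1 + 'X^2) ^+ m * C) x = 0) ->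
  B = 0 /\ C = 0.
Proof.
have [n] := ubnP (size B + size C)%N.
elim: n A B C m => // n IH A B C m lt_n ABC0.
have [E defE] : {E : {poly R} | 1 + 'X^2 = E} by exists (1 + 'X^2).
rewrite defE in IH ABC0.
have dE : E * (E ^+ m)^`() = (m%:R * 2%:R)%:P * 'X * E ^+ m.
  rewrite polyCM !polyC_natr.
  have E' : E^`() = 2%:R * 'X.
    by rewrite -defE derivD derivXn -[1]polyC1 derivC add0r mulr_natl.
  rewrite deriv_exp E'; case: (m) => [|k]; first by rewrite mulr0n mulr0 !mul0r.
  by rewrite -mulr_natr exprS /=; ring.
pose F : {poly R} := B + (2%:R)%:P * 'X * C.
pose A1 : {poly R} := E * A^`() - (m%:R * 2%:R)%:P * 'X * A + E ^+ m * F.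
have dABC x : comb A1 (E ^+ m.+1 * B^`()) (E ^+ m.+1 * C^`()) x = 0.
  have /(congr1 (horner^~ x)) := dE.
  have := deriv_comb0 ABC0 x; have := ABC0 x.
  have EE : E.[x] = 1 + x ^+ 2 by rewrite -defE !hornerE.
  rewrite /comb !derivM /A1 (exprS E) /F.
  rewrite !(hornerD, hornerN, hornerM, hornerC, hornerX) EE.
  set T := atan x; set L := ln _; set P := (E ^+ m).[x].
  set dP := (E ^+ m)^`().[x] => h0 h1 hP.
  set m2x := m%:R * 2%:R * x in hP *; set S := B.[x] * T + C.[x] * L.
  apply: etrans (_ : (1 + x ^+ 2) * (A^`().[x] + (dP * B.[x] + P * B^`().[x]) * T
      + (dP * C.[x] + P * C^`().[x]) * L) + (P * B.[x] + 2 * x * (P * C.[x]))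
      - m2x * (A.[x] + P * B.[x] * T + P * C.[x] * L)
      - ((1 + x ^+ 2) * dP - m2x * P) * S = _); first by rewrite /S; ring.
  by rewrite h0 h1 hP subrr mulr0 mul0r !subr0.
have [B'0 C'0] : B^`() = 0 /\ C^`() = 0.
  have [B0|B0] := eqVneq B 0; have [C0|C0] := eqVneq C 0.
  - by rewrite B0 C0 linear0.
  - apply: (IH A1 _ _ m.+1) => //.
    have := lt_size_deriv C0; move: lt_n; rewrite B0 linear0 size_poly0. lia.
  - apply: (IH A1 _ _ m.+1) => //.
    have := lt_size_deriv B0; move: lt_n; rewrite C0 linear0 size_poly0. lia.
  - apply: (IH A1 _ _ m.+1) => //.
    have := lt_size_deriv B0; have := lt_size_deriv C0; move: lt_n. lia.
rewrite B'0 C'0 in dABC.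
have A10 : A1 = 0.
  apply: horner_eq0 => x.
  by have := dABC x; rewrite /comb !mulr0 horner0 !mul0r !addr0.
have F0 : F = 0.
  apply: (@proper_fraction_primitive R m F (- A)).
    rewrite /F (deriv_eq0_const B'0) (deriv_eq0_const C'0).
    rewrite (leq_trans (size_polyD _ _)) // geq_max mulrAC -polyCM.
    rewrite (leq_trans (size_polyC_leq1 _)) //.
    rewrite (leq_trans (size_polyMleq _ _)) // size_polyX addn2 /= ltnS.
    exact: size_polyC_leq1.
  apply/eqP; rewrite -subr_eq0 -A10 defE /A1 derivN polyCM !polyC_natr.
  by apply/eqP; ring.
move: F0; rewrite /F (deriv_eq0_const B'0) (deriv_eq0_const C'0) => F0.
split.
  have /(congr1 (fun p : {poly R} => p`_0)) := F0.
  by rewrite coef0 coefD coefC mulrAC coefMX addr0 /= => ->.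
have /(congr1 (fun p : {poly R} => p`_1)) := F0.
rewrite coef0 coefD coefC mulrAC -polyCM coefMX add0r coefC /= => /eqP.
by rewrite mulf_eq0 pnatr_eq0 => /eqP ->.
Qed.
End Comb.

Section Coefs.
Variable R : realType.

Definition iterlnA n : {poly R} := (2%:R / n`!%:R) *: apart R n.
Definition iterlnB n : {poly R} := (2%:R / n`!%:R) *: im_pow R n.
Definition iterlnC n : {poly R} := n`!%:R^-1 *: re_pow R n.

Lemma iterlnE n : @iterln R n = comb (iterlnA n) (iterlnB n) (iterlnC n).
Proof.
elim: n => [|n IH].
  rewrite /iterlnA /iterlnB /iterlnC /apart /re_pow /im_pow /=; apply/funext => x.
  rewrite /comb big_geq // !scaler0 !horner0 mul0r !add0r invr1 scale1r.
  by rewrite hornerC mul1r.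
have factSV : n.+1`!%:R^-1 * n.+1%:R = n`!%:R^-1 :> R.
  by rewrite factS natrM invfM mulrAC mulVf ?mul1r // pnatr_eq0.
have dC : (iterlnC n.+1)^`() = iterlnC n.
  rewrite /iterlnC derivZ deriv_re_pow -polyC_natr mul_polyC scalerA.
  by rewrite factSV.
have dB : (iterlnB n.+1)^`() = iterlnB n.
  rewrite /iterlnB derivZ deriv_im_pow -polyC_natr mul_polyC scalerA.
  by rewrite -mulrA factSV.
have dA : (iterlnA n.+1)^`() = iterlnA n - (2%:R / n.+1`!%:R) *: re_pow R n.
  by rewrite /iterlnA derivZ deriv_apart scalerBr scalerA -mulrA factSV.
apply/funext => x /=; rewrite IH.
set F := comb (iterlnA n.+1) (iterlnB n.+1) (iterlnC n.+1).
have F0 : F 0 = 0.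
  rewrite /F /comb expr0n addr0 ln1 atan0 !mulr0 !addr0 /iterlnA hornerZ.
  rewrite /apart horner_sum big_nat big1 ?mulr0 // => k /andP[k_gt0 _].
  by rewrite hornerZ hornerM hornerXn expr0n gtn_eqF // mul0r mulr0.
rewrite -[RHS]subr0 -[in RHS]F0; apply: oint_derive.
- move=> y; apply: (is_derive_eq (is_derive_comb _ _ _ y)).
  rewrite dA dB dC /comb.
  have h := congr1 (horner^~ y) (im_powDre_pow R n).
  have nz := lt0r_neq0 (sqrD1_gt0 y).
  have {}h : (im_pow R n.+1).[y] + y * (re_pow R n.+1).[y] =
             (1 + y ^+ 2) * (re_pow R n).[y].
    move: h; rewrite hornerD !hornerM [(1 + _).[_]]hornerD hornerXn.
    by rewrite hornerX hornerC.
  rewrite hornerD hornerN [in X in _ + X / _]/iterlnB.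
  rewrite [in X in _ + X / _]/iterlnC !hornerZ.
  have -> : 2 / n.+1`!%:R * (im_pow R n.+1).[y] +
      2 * y * (n.+1`!%:R^-1 * (re_pow R n.+1).[y]) =
      2 / n.+1`!%:R * ((1 + y ^+ 2) * (re_pow R n).[y]) by rewrite -h; ring.
  have -> : 2 / n.+1`!%:R * ((1 + y ^+ 2) * (re_pow R n).[y]) / (1 + y ^+ 2) =
      2 / n.+1`!%:R * (re_pow R n).[y].
    by rewrite [(1 + _) * _]mulrC -!mulrA mulfV // mulr1.
  by ring.
- exact: continuous_comb.
Qed.

Lemma iterln_coefsE n : iterln_coefs R n = (iterlnA n, iterlnB n, iterlnC n).
Proof.
rewrite /iterln_coefs; case: xgetP => [[[A B] C] _ /= dec|]; last first.
  by move/(_ (iterlnA n, iterlnB n, iterlnC n)); case=> x /=; rewrite iterlnE.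
have h x : comb (A - iterlnA n) (B - iterlnB n) (C - iterlnC n) x = 0.
  have := dec x; rewrite iterlnE /comb !hornerD !hornerN => /eqP.
  by rewrite -subr_eq0 => /eqP h; rewrite -[RHS]oppr0 -[in RHS]h; ring.
have [B0 C0] : B - iterlnB n = 0 /\ C - iterlnC n = 0.
  apply: (@comb_free _ (A - iterlnA n) _ _ 0) => x.
  by rewrite expr0 !mul1r h.
have A0 : A - iterlnA n = 0.
  apply: horner_eq0 => x.
  by have := h x; rewrite B0 C0 /comb !horner0 !mul0r !addr0.
by congr (_, _, _); apply/eqP; rewrite -subr_eq0; apply/eqP.
Qed.
End Coefs.

Theorem theorem4p6 (R : realType) (n : nat) (hn : (1 <= n)%N) :
  map_poly (real_complex R) (A2 R n) =
    (('i%C * n`!%:R)^-1 : R[i]) *: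
      \sum_(1 <= k < n.+1)
        ((acoef k)%:~R^-1 : R[i]) *:
          ('X^k * (('X + ('i%C)%:P) ^+ (n - k + 1)
                   - ('X - ('i%C)%:P) ^+ (n - k + 1)))
  /\
  A2 R n =
    (n`!%:R^-1 : R) *:
      \sum_(1 <= k < n.+1)
        ((n - k + 1)`!%:R / (acoef k)%:~R : R) *:
          ('X^k * B2 R (n - k + 1)).
Proof.
have -> : A2 R n = iterlnA R n by rewrite /A2 iterln_coefsE.
split.
  rewrite /iterlnA /apart map_polyZ /=.
  rewrite [map_poly _ (\sum_(_ <= _ < _) _)]rmorph_sum /=.
  rewrite !scaler_sumr; apply: eq_bigr => k _.
  have [-> ->] := reim_powE R (n - k + 1).
  rewrite map_polyZ [map_poly _ ('X^k * _)]rmorphM /= map_polyXn.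
  rewrite fmorphV rmorph_int fmorph_div rmorphMn /= !rmorph_nat.
  set X := 'X^k; set V := map_poly _ _; set U := map_poly _ _.
  have -> : U + 'i%C%:P * V - (U - 'i%C%:P * V) = (2 * 'i%C) *: V.
    by rewrite -mul_polyC polyCM polyC_natr; ring.
  rewrite -[X * (_ *: V)]scalerAr !scalerA.
  congr (_ *: _).
  have i0 : 'i%C != 0 :> R[i] by rewrite eq_complex /= oner_eq0 andbF.
  rewrite invfM rmorph1.
  transitivity (2 / n`!%:R / (acoef k)%:~R * ('i%C^-1 * 'i%C) : R[i]).
    by rewrite mulVf // mulr1.
  by ring.
rewrite /iterlnA /apart !scaler_sumr; apply: eq_bigr => k _.
rewrite /B2 iterln_coefsE /= /iterlnB -scalerAr !scalerA; congr (_ *: _).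
have f0 : (n - k + 1)`!%:R != 0 :> R by rewrite pnatr_eq0 -lt0n fact_gt0.
set a := _%:~R.
transitivity (2 / n`!%:R / a * ((n - k + 1)`!%:R / (n - k + 1)`!%:R)).
  by rewrite mulfV ?mulr1.
by ring.
Qed.
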